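(* Let $f\in\mathcal{S}^{1,1}_{\mu,L}(\mathbb{R}^n)$ and $g\in\Gamma_0(\mathbb{R}^n)$, and set $\varphi:=f+g$. Let $x\in\mathbb{R}^n$, $t>0$, $x^+:=\mathbf{prox}_{tg}(x-t\nabla f(x))=x-t\,\mathcal{G}(x,t)$, and $\rho(t):=\max\{|1-Lt|,|1-\mu t|\}$. Then $$\|\mathcal{G}(x^+,t)\|\leq d(0,\partial\varphi(x^+))\leq\rho(t)\|\mathcal{G}(x,t)\|\leq\rho(t)\,d(0,\partial\varphi(x)).$$ In particular, if $f\in\mathcal{F}^{1,1}_{L}(\mathbb{R}^n)$, $g\in\Gamma_0(\mathbb{R}^n)$ and $0<t\leq\frac{2}{L}$, then $$\|\mathcal{G}(x^+,t)\|\leq d(0,\partial\varphi(x^+))\leq\|\mathcal{G}(x,t)\|\leq d(0,\partial\varphi(x)).$$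
   Context: Constants $L>0$ and $\mu\geq 0$. $\mathcal{S}^{1,1}_{\mu,L}(\mathbb{R}^n)$ is the class of differentiable functions $f:\mathbb{R}^n\to\mathbb{R}$ that are $L$-smooth and $\mu$-strongly convex, i.e. for all $x,y\in\mathbb{R}^n$: $f(y)\leq f(x)+\langle\nabla f(x),y-x\rangle+\frac{L}{2}\|y-x\|^2$ and $f(y)\geq f(x)+\langle\nabla f(x),y-x\rangle+\frac{\mu}{2}\|y-x\|^2$. $\mathcal{F}^{1,1}_L(\mathbb{R}^n):=\mathcal{S}^{1,1}_{0,L}(\mathbb{R}^n)$ is the class of $L$-smooth convex functions. $\Gamma_0(\mathbb{R}^n)$ is the class of proper closed convex functions $\mathbb{R}^n\to(-\infty,+\infty]$. The norm is the one induced by the inner product $\langle\cdot,\cdot\rangle$. The proximal mapping is $\mathbf{prox}_{tg}(x):=\arg\min_{y\in\mathbb{R}^n}\{g(y)+\frac{1}{2t}\|y-x\|^2\}$, and the proximal gradient mapping is $\mathcal{G}(x,t):=t^{-1}\left(x-\mathbf{prox}_{tg}(x-t\nabla f(x))\right)$ for $t>0$. $\partial\varphi(x)=\{y:\varphi(u)\geq\varphi(x)+\langle y,u-x\rangle\ \forall u\in\mathbb{R}^n\}$ is the convex subdifferential (so $\partial\varphi(x)=\nabla f(x)+\partial g(x)$, empty where $g(x)=+\infty$), and $d(0,Q):=\inf_{y\in Q}\|y\|$, with $d(0,\emptyset)=+\infty$ (and $0\cdot(+\infty)=0$). *)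

(* Defs.v *)
From HB Require Import structures.
From mathcomp Require Import all_boot all_order all_algebra.
From mathcomp Require Import all_classical all_reals all_analysis.
Set Implicit Arguments.
Unset Strict Implicit.
Unset Printing Implicit Defensive.
Import Order.TTheory GRing.Theory Num.Theory.
Import numFieldNormedType.Exports.
Local Open Scope classical_set_scope.
Local Open Scope ring_scope.

(* R^n is 'rV[R]_n.  Its library norm `|x| is the sup norm: it is only used,
   through the topology, by [differentiable] and [closed].  All the
   quantitative statements use the Euclidean norm [enorm]. *)

Section ProximalGradient.
Context {R : realType} {n : nat}.
Implicit Types (f : 'rV[R]_n -> R) (g phi : 'rV[R]_n -> \bar R).
Implicit Types (x y z : 'rV[R]_n) (mu L t : R).

Definition inner x y : R := \sum_(i < n) x ord0 i * y ord0 i.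

Definition enorm x : R := Num.sqrt (inner x x).

Definition grad f x : 'rV[R]_n := \row_(i < n) 'D_(delta_mx ord0 i) f x.

Definition strongly_convex_smooth mu L f : Prop :=
  (forall x, differentiable f x) /\
  (forall x y,
     f y <= f x + inner (grad f x) (y - x) + L / 2 * enorm (y - x) ^+ 2 /\
     f y >= f x + inner (grad f x) (y - x) + mu / 2 * enorm (y - x) ^+ 2).

Definition convex_smooth L f : Prop := strongly_convex_smooth 0 L f.

Definition proper_fun g : Prop :=
  (forall x, g x != -oo%E) /\ (exists x, g x != +oo%E).

Definition closed_fun g : Prop :=
  closed [set p : 'rV[R]_n * R | (g p.1 <= p.2%:E)%E].

(* For 0 <= a <= 1 and g > -oo no undefined sum occurs, and 0 * +oo = 0. *)
Definition convex_fun g : Prop :=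
  forall x y (a : R), 0 <= a <= 1 ->
    (g (a *: x + (1 - a) *: y)%R <= a%:E * g x + (1 - a)%:E * g y)%E.

Definition Gamma0 g : Prop := [/\ proper_fun g, closed_fun g & convex_fun g].

Definition argmin phi : set 'rV[R]_n :=
  [set y | forall u, (phi y <= phi u)%E].

(* [prox t g x] is the element of the argmin; the choice operator [xget] would
   return 0 if the argmin were empty, which does not occur for g in Gamma0
   and t > 0, where the argmin is a singleton. *)
Definition prox t g x : 'rV[R]_n :=
  xget 0 (argmin (fun y => (g y + ((2 * t)^-1 * enorm (y - x)%R ^+ 2)%:E)%E)).

Definition prox_grad f g x t : 'rV[R]_n :=
  t^-1 *: (x - prox t g (x - t *: grad f x)).

Definition subdiff phi x : set 'rV[R]_n :=
  [set y | forall u, (phi x + (inner y (u - x)%R)%:E <= phi u)%E].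

Definition dist0 (Q : set 'rV[R]_n) : \bar R :=
  ereal_inf [set (enorm y)%:E | y in Q].

Definition addfg f g : 'rV[R]_n -> \bar R := fun x => ((f x)%:E + g x)%E.

End ProximalGradient.

(* Main.v *)
(* Subgradients at the prox point and optimality conditions come from one fact:
   if f has a quadratic upper bound at x with slope d, then subtracting d from a
   subgradient of f + g at x leaves a subgradient of g.  Applied to the proximal
   objective it puts G(x, t) - grad f x in the subdifferential of g at x^+, so
   w := G(x, t) - grad f x + grad f x^+ is a subgradient of f + g at x^+, and
   t w = (I - t grad f) x - (I - t grad f) x^+; the middle inequality is the
   rho(t)-Lipschitz continuity of the gradient step, a consequence of
   cocoercivity.  The outer inequalities follow from the monotonicity of the
   subdifferential of g between x and x^+.  The minimum defining prox exists
   because g, being bounded below on a ball, has at most linear decay by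
   convexity, while the proximal term grows quadratically. *)
Require Import Defs.
From mathcomp Require Import all_boot all_order all_algebra.
From mathcomp Require Import all_classical all_reals all_analysis.
From mathcomp Require Import ring lra.
Set Implicit Arguments.
Unset Strict Implicit.
Unset Printing Implicit Defensive.
Import Order.TTheory GRing.Theory Num.Theory.
Import numFieldNormedType.Exports.
Local Open Scope classical_set_scope.
Local Open Scope ring_scope.

(** * Minimizers on compact sets *)

(** The sublevel sets [B u] are nested, so they generate a proper filter on [K], which has a cluster
    point [p]. If [h u < h p], semicontinuity keeps [h] above [h u] near [p], yet [B u] has points
    there. *)
Lemma lsc_compact_min (R : realType) (T : topologicalType) (h : T -> \bar R)
    (K : set T) :
  compact K -> K !=set0 -> lower_semicontinuous h ->
  (forall x, h x != -oo%E) ->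
  exists2 p, K p & forall u, K u -> (h p <= h u)%E.
Proof.
move=> cK [k Kk] lsc hNy.
pose B u := [set y | K y /\ (h y <= h u)%E].
have FF : Filter (filter_from K B).
  apply: filter_from_filter => [|i j Ki Kj]; first by exists k.
  have [hij|/ltW hji] := leP (h i) (h j).
  - by exists i => // y [Ky yi]; split; split => //; exact: le_trans hij.
  - by exists j => // y [Ky yj]; split; split => //; exact: le_trans hji.
have PF : ProperFilter (filter_from K B).
  by apply: filter_from_proper => i Ki; exists i; split.
have [|p [Kp clp]] := cK _ PF; first by exists k => // y [].
exists p => // u Ku; rewrite leNgt; apply/negP => hup.
case huv: (h u) (hNy u) hup => [v||] // _ hup; last first.
  by move: hup; rewrite ltNge leey.
have [V nV Vv] := lsc p v hup.
have [|y [[_ yu] Vy]] := clp (B u) V _ nV; first by exists u.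
by have := lt_le_trans (Vv y Vy) yu; rewrite huv ltxx.
Qed.

(** * Euclidean inner product and norm *)

Section Euclidean.
Context {R : realType} {n : nat}.
Implicit Types (x y z u v w d : 'rV[R]_n) (a : R).

Lemma innerC x y : inner x y = inner y x.
Proof. by apply: eq_bigr => i _; rewrite mulrC. Qed.

Lemma innerDl x y z : inner (x + y) z = inner x z + inner y z.
Proof. by rewrite -big_split; apply: eq_bigr => i _; rewrite !mxE mulrDl. Qed.

Lemma innerZl a x z : inner (a *: x) z = a * inner x z.
Proof. by rewrite mulr_sumr; apply: eq_bigr => i _; rewrite !mxE mulrA. Qed.

Lemma innerNl x z : inner (- x) z = - inner x z.
Proof. by rewrite -scaleN1r innerZl mulN1r. Qed.

Lemma innerDr x y z : inner z (x + y) = inner z x + inner z y.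
Proof. by rewrite innerC innerDl !(innerC z). Qed.

Lemma innerZr a x z : inner z (a *: x) = a * inner z x.
Proof. by rewrite innerC innerZl (innerC z). Qed.

Lemma innerNr x z : inner z (- x) = - inner z x.
Proof. by rewrite innerC innerNl (innerC z). Qed.

Definition innerE := (innerDl, innerDr, innerNl, innerNr, innerZl, innerZr).

Lemma inner_ge0 x : 0 <= inner x x.
Proof. by apply: sumr_ge0 => i _; rewrite -expr2 sqr_ge0. Qed.

Lemma enorm_ge0 x : 0 <= enorm x.
Proof. exact: sqrtr_ge0. Qed.

Lemma enorm_sqr x : enorm x ^+ 2 = inner x x.
Proof. by rewrite sqr_sqrtr ?inner_ge0. Qed.

Lemma enorm_le x y a :
  0 <= a -> inner x x <= a ^+ 2 * inner y y -> enorm x <= a * enorm y.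
Proof.
move=> a0 xy; rewrite -ler_sqr ?nnegrE ?mulr_ge0 ?enorm_ge0//.
by rewrite exprMn !enorm_sqr.
Qed.

(** Links the Euclidean norm to the sup norm, whose closed balls are the compact sets used for
    minimization. *)
Lemma norm_le_enorm x : `|x| <= enorm x.
Proof.
rewrite /Num.Def.normr/= mx_normrE; apply/bigmax_leP => /=; split; first exact: enorm_ge0.
case=> i j _ /=; rewrite ord1 -ler_sqr ?nnegrE ?normr_ge0 ?enorm_ge0//.
rewrite enorm_sqr real_normK ?num_real// /inner (bigD1 j)//= expr2 lerDl.
by apply: sumr_ge0 => k _; rewrite -expr2 sqr_ge0.
Qed.

Lemma continuous_enorm_sqr : continuous (fun y => enorm y ^+ 2).
Proof.
have -> : (fun y => enorm y ^+ 2) = (fun y => \sum_(i < n) y ord0 i * y ord0 i).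
  by apply/funext => y; rewrite enorm_sqr.
apply: continuous_big => [|i _ y]; first exact: add_continuous.
have c := @coord_continuous R 1 n ord0 i y.
exact: (cvgM c c).
Qed.

(** * Existence of the proximal point *)

(** A sublevel set of the sum is the preimage of the closed epigraph of [g] under the continuous map
    [y |-> (y, a - q y)]. *)
Lemma closed_fun_lsc_add (g : 'rV[R]_n -> \bar R) (q : 'rV[R]_n -> R) :
  closed_fun g -> continuous q ->
  lower_semicontinuous (fun y => (g y + (q y)%:E)%E).
Proof.
move=> cg cq; apply/lower_semicontinuousP => a.
rewrite -closedC.
have -> : ~` [set y | (a%:E < g y + (q y)%:E)%E]
    = (fun y => (y, a - q y)) @^-1` [set p | (g p.1 <= p.2%:E)%E].
  apply/seteqP; split=> y /=.
    by move/negP; rewrite -leNgt EFinB leeBrDr.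
  by move=> gy; apply/negP; rewrite -leNgt -leeBrDr.
have cyq : continuous (fun y => (y, a - q y)).
  move=> y; have cid : id x @[x --> y] --> y by exact: cvg_id.
  have caq : a - q x @[x --> y] --> a - q y by exact: (cvgB (cvg_cst a) (cq y)).
  exact: (cvg_pair cid caq).
exact: (proj1 (continuous_closedP _) cyq _ cg).
Qed.

Lemma closed_ball_compact x (r : R) : 0 < r -> compact (closed_ball x r).
Proof.
move=> r0; apply: bounded_closed_compact; last exact: closed_ball_closed.
exists (`|x| + r); split; first exact: num_real.
move=> M M_gt y; rewrite closed_ballE// /closed_ball_/= => xy.
apply: le_trans (ltW M_gt); rewrite -lerBlDl.
by apply: le_trans (lerB_dist _ _) _; rewrite distrC.
Qed.

(** Serves twice: [q = 0] bounds [g] below on a ball, and the proximal term as [q] yields the prox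
    point. *)
Lemma Gamma0_min_closed_ball (g : 'rV[R]_n -> \bar R) (q : 'rV[R]_n -> R) x
    (r : R) :
  Gamma0 g -> continuous q -> 0 < r ->
  exists2 p, closed_ball x r p &
    forall u, `|x - u| <= r -> (g p + (q p)%:E <= g u + (q u)%:E)%E.
Proof.
move=> [[gNy _] cg _] cq r0.
have [||||p Kp pmin] := @lsc_compact_min R _ (fun y => g y + (q y)%:E)%E
  (closed_ball x r).
- exact: closed_ball_compact.
- by exists x; exact: closed_ballxx.
- exact: closed_fun_lsc_add.
- by move=> y; have := gNy y; case: (g y).
- by exists p => // u xu; apply: pmin; rewrite closed_ballE.
Qed.

(* Shrink y towards x onto the unit sphere around x, where g is bounded below. *)
Lemma Gamma0_linear_minorant (g : 'rV[R]_n -> \bar R) x :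
  Gamma0 g -> g x != +oo%E ->
  exists2 B : R, 0 <= B &
    forall y, 1 <= `|x - y| -> ((- (B * `|x - y|))%:E <= g y)%E.
Proof.
move=> Gg gx; have [[gNy _] _ conv_g] := Gg.
have [p _] := Gamma0_min_closed_ball x Gg (@cst_continuous _ _ 0) (@ltr01 R).
have xx : `|x - x| <= 1 by rewrite subrr normr0.
case gxE : (g x) (gNy x) gx => [b||] // _ _ pmin.
move: (pmin x xx); rewrite gxE /cst !adde0.
case gpE : (g p) (gNy p) => [c||] // _; rewrite lee_fin => cb.
(* With [r] the value of [g y], convexity at the shrunk point times [N] reads
   [N c <= r + (N - 1) b], whence [r >= - N (|c| + |b|)]. *)
exists (`|c| + `|b|); first by rewrite addr_ge0.
move=> y; set N := `|x - y| => N1.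
have N0 : 0 < N by apply: lt_le_trans N1.
case gyE : (g y) (gNy y) => [r||] // _; rewrite ?leey// lee_fin.
have /conv_g : 0 <= N^-1 <= 1 by rewrite invr_ge0 ltW//= invf_le1.
move=> /(_ y x); set z := (_ + _)%R => gz.
have /pmin : `|x - z| <= 1.
  rewrite (_ : x - z = N^-1 *: (x - y)); last first.
    by apply/rowP => i; rewrite !mxE; ring.
  by rewrite normrZ normfV ger0_norm ?(ltW N0)// mulVf ?gt_eqF.
rewrite gpE /cst !adde0 => /le_trans/(_ gz).
rewrite gyE gxE -!EFinM -EFinD lee_fin -(ler_pM2l N0).
rewrite mulrDr mulrA mulfV ?gt_eqF// mul1r mulrA mulrBr mulfV ?gt_eqF// mulr1.
have := ler_norm b; have := ler_norm (- c); rewrite normrN.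
have := normr_ge0 b.
nra.
Qed.

Lemma prox_min_exists (g : 'rV[R]_n -> \bar R) (t : R) z :
  0 < t -> Gamma0 g ->
  exists p, argmin (fun y => g y + ((2 * t)^-1 * enorm (y - z) ^+ 2)%:E)%E p.
Proof.
move=> t0 Gg; have [[gNy [x gx]] _ _] := Gg.
have [B B0 Bg] := Gamma0_linear_minorant Gg gx.
set q := fun y => (2 * t)^-1 * enorm (y - z) ^+ 2.
have cq : continuous q.
  have cqz : continuous (fun y => enorm (y - z) ^+ 2).
    move=> y; have cyz : {for y, continuous (fun y => y - z)}.
      exact: (cvgB (@cvg_id _ _) (cvg_cst z)).
    exact: (continuous_comp cyz (@continuous_enorm_sqr _)).
  by move=> y; exact: (cvgM (cvg_cst _) (cqz y)).
case gxE : (g x) (gNy x) gx => [b||] // _ _.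
set Z := `|x - z|; set m := b + q x.
have Z0 : 0 <= Z by exact: normr_ge0.
(* For [S = N - Z > k], [S^2 / (2 t) >= (B + B Z + |m|) S]. Since also [S >= 1], this is at least
   [B N + m], so no point outside the ball does better than [x]. *)
pose k := 2 * t * (B + B * Z + `|m|) + 1.
have A0 : 0 <= B + B * Z + `|m| by rewrite !addr_ge0// mulr_ge0.
have k1 : 1 <= k by rewrite lerDr !mulr_ge0// ltW.
have r0 : 0 < Z + k by lra.
have [p _ pmin] := Gamma0_min_closed_ball x Gg cq r0.
exists p => u; have [/pmin//|far] := leP `|x - u| (Z + k).
have xx : `|x - x| <= Z + k by rewrite subrr normr0 ltW.
apply: le_trans (pmin x xx) _; rewrite gxE -EFinD -/m.
have N1 : 1 <= `|x - u| by lra.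
apply: (@le_trans _ _ ((- (B * `|x - u|))%:E + (q u)%:E)%E); last first.
  by apply: leeD; [exact: Bg|].
rewrite -EFinD lee_fin /q; set N := `|x - u| in far N1 *.
have uz : N - Z <= `|u - z|.
  rewrite lerBlDr addrC.
  by apply: le_trans (ler_distD z x u) _; rewrite (distrC u z).
have uze : (N - Z) ^+ 2 <= enorm (u - z) ^+ 2.
  rewrite ler_sqr ?nnegrE ?enorm_ge0//; last lra.
  exact: le_trans uz (norm_le_enorm _).
apply: (@le_trans _ _ (- (B * N) + (2 * t)^-1 * (N - Z) ^+ 2)); last first.
  by rewrite lerD2l ler_pM2l// invr_gt0 mulr_gt0.
have t20 : 0 < 2 * t by rewrite mulr_gt0.
have : (2 * t)^-1 * (N - Z) ^+ 2 >= (B + B * Z + `|m|) * (N - Z).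
  rewrite [leRHS]mulrC ler_pdivlMr// expr2 mulrAC ler_pM2r; last lra.
  by rewrite mulrC; move: far; rewrite /k; lra.
have := ler_norm m.
have : 0 <= B * Z by rewrite mulr_ge0.
have : 0 <= `|m| by [].
have : 1 <= N - Z by lra.
set S := N - Z; have -> : N = S + Z by rewrite /S subrK.
nra.
Qed.

(** * Subdifferential calculus *)

Lemma le_of_le_add_small (A B C : R) :
  (forall a, 0 < a <= 1 -> A <= B + a * C) -> A <= B.
Proof.
move=> ABC; apply/ler_addgt0Pr => e e0.
have C0 : 0 < `|C| + 1 by rewrite ltr_pwDr.
pose a := Num.min 1 (e / (`|C| + 1)).
have a0 : 0 < a by rewrite lt_min ltr01 divr_gt0.
have /ABC/le_trans : 0 < a <= 1 by rewrite a0 ge_min lexx.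
apply; rewrite lerD2l; apply: (@le_trans _ _ (a * (`|C| + 1))).
  by rewrite ler_pM2l//; apply: le_trans (ler_norm _) _; rewrite lerDl.
by rewrite -ler_pdivlMr// ge_min lexx orbT.
Qed.

(** Test the subgradient inequality at [z = x + a (u - x)] and bound [g z] by convexity. The
    quadratic error is of order [a^2]; dividing by [a] and letting [a] tend to 0 removes it. *)
Lemma subdiff_addfg_sub (f : 'rV[R]_n -> R) (g : 'rV[R]_n -> \bar R) x d v
    (C : R) :
  convex_fun g -> (forall y, g y != -oo%E) -> g x != +oo%E ->
  (forall u, f u <= f x + inner d (u - x) + C * inner (u - x) (u - x)) ->
  subdiff (addfg f g) x v -> subdiff g x (v - d).
Proof.
move=> cg gNy gx fub vx u.
case gxE : (g x) (gNy x) gx => [b||] // _ _.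
case guE : (g u) (gNy u) => [r||] // _; last by rewrite leey.
rewrite -EFinD lee_fin.
apply: (@le_of_le_add_small _ _ (C * inner (u - x) (u - x))) => a /andP[a0 a1].
have /(cg u x) : 0 <= a <= 1 by rewrite ltW.
set z := (_ + _)%R; have zx : z - x = a *: (u - x).
  by apply/rowP => i; rewrite !mxE; ring.
rewrite guE gxE; move: (vx z); rewrite /addfg gxE.
case: (g z) (gNy z) => [c||] // _.
rewrite -!EFinM -!EFinD !lee_fin => vz gz.
have := fub z; move: vz; rewrite zx !innerE => vz fz.
rewrite -(ler_pM2l a0); nra.
Qed.

Lemma subdiff_addfg (f : 'rV[R]_n -> R) (g : 'rV[R]_n -> \bar R) x d v :
  (forall u, f x + inner d (u - x) <= f u) ->
  subdiff g x v -> subdiff (addfg f g) x (d + v).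
Proof.
move=> fx gx u; rewrite innerDl EFinD addeACA -EFinD.
by apply: leeD; [rewrite lee_fin|exact: gx].
Qed.

Lemma subdiff_monotone (g : 'rV[R]_n -> \bar R) x y v w :
  g x \is a fin_num -> g y \is a fin_num ->
  subdiff g x v -> subdiff g y w -> 0 <= inner (v - w) (x - y).
Proof.
case gxE : (g x) => [b||] //; case gyE : (g y) => [c||] // _ _.
move=> /(_ y); rewrite gxE gyE -EFinD lee_fin => gxy.
move=> /(_ x); rewrite gxE gyE -EFinD lee_fin => gyx.
by move: gxy gyx; rewrite !innerE; lra.
Qed.

Lemma prox_subdiff (g : 'rV[R]_n -> \bar R) (t : R) z :
  0 < t -> Gamma0 g ->
  g (prox t g z) \is a fin_num /\
  subdiff g (prox t g z) (t^-1 *: (z - prox t g z)).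
Proof.
move=> t0 Gg; have [[gNy [x0 gx0]] _ cg] := Gg.
have pmin := xgetPex 0 (prox_min_exists z t0 Gg).
rewrite -/(prox t g z) in pmin; set p := prox t g z in pmin *.
have gp : g p != +oo%E.
  move: (pmin x0); case: (g x0) (gNy x0) gx0 => [b||] // _ _.
  by case: (g p).
split; first by rewrite fin_numE gNy gp.
(* The minimizer [p] has subgradient [0], and [t^-1 *: (p - z)] is the slope at [p] of the quadratic
   term, whose expansion is exact with [C = (2 * t)^-1]. *)
rewrite (_ : _ *: _ = 0 - t^-1 *: (p - z)); last first.
  by rewrite sub0r -scalerN opprB.
apply: (@subdiff_addfg_sub (fun y => (2 * t)^-1 * enorm (y - z) ^+ 2) _ _ _ _
  (2 * t)^-1) => // u.
  rewrite !enorm_sqr !innerE (innerC p u) (innerC z u) (innerC z p).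
  by rewrite le_eqVlt; apply/orP; left; apply/eqP; field; rewrite gt_eqF.
rewrite /inner big1 ?adde0 => [|i _]; last by rewrite mxE mul0r.
by rewrite /addfg !(addeC _ (g _)).
Qed.

(** * Cocoercivity and the gradient step *)

Section SmoothStronglyConvex.
Variables (mu L : R) (f : 'rV[R]_n -> R).
Hypothesis fS : strongly_convex_smooth mu L f.

Let ub x y :
  f y <= f x + inner (grad f x) (y - x) + L / 2 * inner (y - x) (y - x).
Proof. by have [_ /(_ x y)[]] := fS; rewrite enorm_sqr. Qed.

Let lb x y :
  f x + inner (grad f x) (y - x) + mu / 2 * inner (y - x) (y - x) <= f y.
Proof. by have [_ /(_ x y)[]] := fS; rewrite enorm_sqr. Qed.

Lemma grad_strongly_monotone x y :
  mu * inner (x - y) (x - y) <= inner (grad f x - grad f y) (x - y).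
Proof.
have := lb x y; have := lb y x.
rewrite !innerE (innerC y x).
lra.
Qed.

Lemma grad_le_smooth x y :
  inner (grad f x - grad f y) (x - y) <= L * inner (x - y) (x - y).
Proof.
have := ub x y; have := ub y x.
rewrite !innerE (innerC y x).
lra.
Qed.

(** The gradient difference of [f - (mu / 2) |.|^2], which is convex and [(L - mu)]-smooth. *)
Definition grad_gap x y : 'rV[R]_n := grad f x - grad f y - mu *: (x - y).

(* Compare the quadratic upper bound at y with the lower bound at x at the
   point y + s * grad_gap x y, and symmetrically. *)
Lemma grad_cocoercive_step x y (s : R) :
  (2 * s - (L - mu) * s ^+ 2) * inner (grad_gap x y) (grad_gap x y)
    <= inner (grad_gap x y) (x - y).
Proof.
set d := x - y; set e := grad_gap x y.
have yx : y - x = - d by rewrite opprB.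
have : f x + inner (grad f x) (y + s *: e - x)
    + mu / 2 * inner (y + s *: e - x) (y + s *: e - x)
    <= f y + inner (grad f y) (y + s *: e - y)
    + L / 2 * inner (y + s *: e - y) (y + s *: e - y).
  exact: le_trans (lb _ _) (ub _ _).
have : f y + inner (grad f y) (x - s *: e - y)
    + mu / 2 * inner (x - s *: e - y) (x - s *: e - y)
    <= f x + inner (grad f x) (x - s *: e - x)
    + L / 2 * inner (x - s *: e - x) (x - s *: e - x).
  exact: le_trans (lb _ _) (ub _ _).
rewrite (_ : y + s *: e - x = s *: e - d); last by rewrite -yx addrAC addrC.
rewrite (_ : y + s *: e - y = s *: e); last by rewrite addrAC subrr add0r.
rewrite (_ : x - s *: e - y = d - s *: e); last by rewrite addrAC.
rewrite (_ : x - s *: e - x = - (s *: e)); last by rewrite addrAC subrr add0r.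
have ge v : inner (grad f x) v = inner (grad f y) v + inner e v + mu * inner d v.
  by rewrite /e /grad_gap !innerE; ring.
clearbody e d; rewrite !innerE !ge (innerC d e); lra.
Qed.

Lemma grad_cocoercive x y :
  mu <= L ->
  inner (grad_gap x y) (grad_gap x y) <= (L - mu) * inner (grad_gap x y) (x - y).
Proof.
set e := grad_gap x y; set d := x - y; rewrite le_eqVlt => /predU1P[muL|muL].
  have := grad_cocoercive_step x y; rewrite -/e -/d -muL subrr => step.
  have := inner_ge0 e; rewrite le_eqVlt => /predU1P[<-|e0].
    by rewrite mul0r.
  (* If [L = mu], the factor [2 s] is unbounded; this [s] would give [inner e d + 1 <= inner e d],
     so [e] must vanish. *)
  have := step ((inner e d + 1) / (2 * inner e e)).
  rewrite (_ : _ * inner e e = inner e d + 1) ?gerDl ?ler10//.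
  by field; rewrite gt_eqF.
(* This [s] maximizes [2 s - (L - mu) s^2]. *)
have := grad_cocoercive_step x y (L - mu)^-1; rewrite -/d -/e.
rewrite (_ : _ - _ * _ = (L - mu)^-1); last by field; rewrite subr_eq0 gt_eqF.
by rewrite mulrC ler_pdivrMr ?subr_gt0// mulrC.
Qed.

(** Cocoercivity amounts to [|D|^2 <= (mu + L) <D, d> - mu L |d|^2]. Inserted into [|d - t D|^2], it
    leaves an expression affine in [<D, d>], equal to [(1 - mu t)^2 |d|^2] and [(1 - L t)^2 |d|^2]
    at the two ends of its range. *)
Lemma gradient_step_lipschitz x y (t : R) :
  0 <= t ->
  enorm (x - y - t *: (grad f x - grad f y))
    <= Num.max `|1 - L * t| `|1 - mu * t| * enorm (x - y).
Proof.
move=> t0; set r := Num.max _ _.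
have r0 : 0 <= r by rewrite le_max normr_ge0.
have rL : (1 - L * t) ^+ 2 <= r ^+ 2.
  by rewrite -(real_normK (num_real _)) ler_sqr ?nnegrE// le_max lexx.
have rmu : (1 - mu * t) ^+ 2 <= r ^+ 2.
  by rewrite -(real_normK (num_real _)) ler_sqr ?nnegrE// le_max lexx orbT.
apply: enorm_le => //.
set d := x - y; set D := grad f x - grad f y.
(* The case [d = 0] is set apart because [mu <= L] is obtained by dividing by [|d|^2]. *)
have := inner_ge0 d; rewrite le_eqVlt => /predU1P[d0|d0].
  have xy : x = y.
    apply/eqP; rewrite -subr_eq0 -normr_le0.
    apply: le_trans (norm_le_enorm _) _.
    by rewrite /enorm -/d -d0 sqrtr0.
  by rewrite /d /D xy !subrr scaler0 subr0 -(scale0r 0) innerZl mul0r mulr0.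
have muD : mu * inner d d <= inner D d := grad_strongly_monotone x y.
have DL : inner D d <= L * inner d d := grad_le_smooth x y.
have muL : mu <= L by rewrite -(ler_pM2r d0); exact: le_trans DL.
have := grad_cocoercive x y muL; rewrite /grad_gap -/d -/D.
clearbody d D; rewrite !innerE (innerC d D) => coco.
suff : (1 - t ^+ 2 * (mu * L)) * inner d d
    + (t ^+ 2 * (mu + L) - 2 * t) * inner D d <= r ^+ 2 * inner d d.
  by apply: le_trans; nra.
have rLd : (1 - L * t) ^+ 2 * inner d d <= r ^+ 2 * inner d d by rewrite ler_pM2r.
have rmud : (1 - mu * t) ^+ 2 * inner d d <= r ^+ 2 * inner d d by rewrite ler_pM2r.
(* The left-hand side is affine in <D, d>, which lies in [mu |d|^2, L |d|^2]. *)
have [k0|k0] := leP 0 (t ^+ 2 * (mu + L) - 2 * t).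
  by apply: le_trans rLd; nra.
by apply: le_trans rmud; nra.
Qed.

End SmoothStronglyConvex.

(** * The proximal gradient step *)

Lemma enorm_le_dist0 (Q : set 'rV[R]_n) a :
  (forall v, Q v -> a <= enorm v) -> (a%:E <= dist0 Q)%E.
Proof. by move=> aQ; apply: le_ereal_inf_tmp => _ [v Qv <-]; rewrite lee_fin aQ. Qed.

Lemma dist0_le_enorm (Q : set 'rV[R]_n) v : Q v -> (dist0 Q <= (enorm v)%:E)%E.
Proof. by move=> Qv; apply: ereal_inf_lbound; exists v. Qed.

Section ProximalGradientStep.
Variables (mu L : R) (f : 'rV[R]_n -> R) (g : 'rV[R]_n -> \bar R) (t : R).
Hypotheses (fS : strongly_convex_smooth mu L f) (Gg : Gamma0 g) (t0 : 0 < t).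

Lemma scale_prox_grad x :
  t *: prox_grad f g x t = x - prox t g (x - t *: grad f x).
Proof. by rewrite /prox_grad scalerA mulfV ?gt_eqF// scale1r. Qed.

Lemma prox_grad_subdiff x :
  subdiff g (prox t g (x - t *: grad f x)) (prox_grad f g x t - grad f x).
Proof.
have [_] := prox_subdiff (x - t *: grad f x) t0 Gg.
congr (subdiff g _ _); rewrite /prox_grad addrAC scalerBr scalerA.
by rewrite mulVf ?gt_eqF// scale1r.
Qed.

(** Monotonicity between [x] and the prox point gives [<v - G, G> >= 0], so [|v|^2 >= |G|^2]. Both
    outer inequalities are instances, at [x] and at [xp]. *)
Lemma enorm_prox_grad_le x v :
  subdiff (addfg f g) x v -> enorm (prox_grad f g x t) <= enorm v.
Proof.
move=> vx; have [[gNy [x0 gx0]] _ cg] := Gg.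
(* A subgradient exists at [x], so an infinite [g x] would force [g x0] to be infinite. *)
have gx : g x != +oo%E.
  apply/eqP => gx; move: (vx x0); rewrite /addfg gx.
  by case: (g x0) (gNy x0) gx0.
have vg : subdiff g x (v - grad f x).
  apply: (subdiff_addfg_sub cg gNy gx _ vx) => u.
  by have [_ /(_ x u)[fu _]] := fS; rewrite -enorm_sqr; exact: fu.
have [gp _] := prox_subdiff (x - t *: grad f x) t0 Gg.
have gxf : g x \is a fin_num by rewrite fin_numE gNy gx.
have := subdiff_monotone gxf gp vg (prox_grad_subdiff x).
rewrite -scale_prox_grad opprB addrA subrK.
set G := prox_grad f g x t; clearbody G; rewrite innerZr pmulr_rge0// => vG.
rewrite -[leRHS]mul1r; apply: enorm_le => //.
by have := inner_ge0 (v - G); move: vG; rewrite !innerE (innerC G v); lra.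
Qed.

Lemma dist0_prox_le x :
  0 <= mu ->
  (dist0 (subdiff (addfg f g) (prox t g (x - t *: grad f x)))
    <= (Num.max `|1 - L * t| `|1 - mu * t| * enorm (prox_grad f g x t))%:E)%E.
Proof.
move=> mu0; set xp := prox _ _ _; set G := prox_grad f g x t.
have fcvx u : f xp + inner (grad f xp) (u - xp) <= f u.
  have [_ /(_ xp u)[_]] := fS; apply: le_trans.
  by rewrite lerDl mulr_ge0 ?sqr_ge0// divr_ge0.
apply: le_trans (dist0_le_enorm (subdiff_addfg fcvx (prox_grad_subdiff x))) _.
rewrite lee_fin -(ler_pM2l t0) mulrCA.
have enormZ w : t * enorm w = enorm (t *: w).
  by rewrite /enorm !innerE mulrA sqrtrM ?mulr_ge0 ?ltW// -expr2 sqrtr_sqr gtr0_norm.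
rewrite !enormZ -/G scale_prox_grad -/xp.
rewrite (_ : t *: _ = x - xp - t *: (grad f x - grad f xp)).
  exact: (gradient_step_lipschitz fS _ _ (ltW t0)).
rewrite -(scale_prox_grad x) -/G -scalerBr; congr (_ *: _).
by rewrite opprB addrCA.
Qed.

End ProximalGradientStep.

End Euclidean.

Theorem theorem3p1 (R : realType) (n : nat) (L : R) (hL : 0 < L) :
  (forall (mu : R) (f : 'rV[R]_n -> R) (g : 'rV[R]_n -> \bar R)
          (x : 'rV[R]_n) (t : R),
     0 <= mu -> strongly_convex_smooth mu L f -> Gamma0 g -> 0 < t ->
     let phi := addfg f g in
     let xp := prox t g (x - t *: grad f x) in
     let rho := Num.max `|1 - L * t| `|1 - mu * t| in
     [/\ xp = x - t *: prox_grad f g x t,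
         ((enorm (prox_grad f g xp t))%:E <= dist0 (subdiff phi xp))%E,
         (dist0 (subdiff phi xp) <= (rho * enorm (prox_grad f g x t))%:E)%E
       & ((rho * enorm (prox_grad f g x t))%:E
            <= rho%:E * dist0 (subdiff phi x))%E])
  /\
  (forall (f : 'rV[R]_n -> R) (g : 'rV[R]_n -> \bar R)
          (x : 'rV[R]_n) (t : R),
     convex_smooth L f -> Gamma0 g -> 0 < t <= 2 / L ->
     let phi := addfg f g in
     let xp := prox t g (x - t *: grad f x) in
     [/\ ((enorm (prox_grad f g xp t))%:E <= dist0 (subdiff phi xp))%E,
         (dist0 (subdiff phi xp) <= (enorm (prox_grad f g x t))%:E)%E
       & ((enorm (prox_grad f g x t))%:E <= dist0 (subdiff phi x))%E]).
Proof.
split=> [mu f g x t mu0 fS Gg t0|f g x t fS Gg /andP[t0 tL]] phi xp.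
  move=> rho; split.
  - by rewrite (scale_prox_grad f g t0) opprB addrC subrK.
  - by apply: enorm_le_dist0 => v; exact: (enorm_prox_grad_le fS Gg t0).
  - exact: (dist0_prox_le fS Gg t0).
  (* The convention [0 * +oo = 0] covers [rho = 0] with an infinite distance. *)
  - rewrite EFinM; apply: lee_wpmul2l; first by rewrite lee_fin le_max normr_ge0.
    by apply: enorm_le_dist0 => v; exact: (enorm_prox_grad_le fS Gg t0).
split.
- by apply: enorm_le_dist0 => v; exact: (enorm_prox_grad_le fS Gg t0).
- have := dist0_prox_le fS Gg t0 x (lexx 0).
  (* With [mu = 0] the second entry of the maximum is 1, and [0 < L t <= 2] keeps the first at most
     1. *)
  rewrite mul0r subr0 normr1 max_r ?mul1r//.
  have : L * t <= 2 by rewrite mulrC -ler_pdivlMr.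
  have : 0 < L * t by rewrite mulr_gt0.
  by rewrite ler_norml; lra.
- by apply: enorm_le_dist0 => v; exact: (enorm_prox_grad_le fS Gg t0).
Qed.
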